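(* Let $R$ be a unit-regular ring and let $a,b,c\in R$ satisfy $aba=aca$. If the group inverses $(ac)^{\#}$ and $(ba)^{\#}$ both exist, then $(ac)^{\#}\sim (ba)^{\#}$, i.e. there is an invertible element $s\in R$ such that $(ac)^{\#}=s^{-1}(ba)^{\#}s$.
   Context: Rings are associative with identity (not necessarily commutative). A ring $R$ is unit-regular if for every $a\in R$ there is an invertible element $u\in R$ with $aua=a$. An element $a\in R$ is group invertible if there is $x\in R$ with $ax=xa$, $xax=x$ and $axa=a$; such an $x$ is unique, is called the group inverse of $a$, and is denoted $a^{\#}$ (one says that $a^{\#}$ exists). Two elements $a,b\in R$ are similar, written $a\sim b$, if $a=s^{-1}bs$ for some invertible $s\in R$. *)

(* Defs.v *)
From HB Require Import structures.
From mathcomp Require Import all_boot all_algebra.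
Set Implicit Arguments.
Unset Strict Implicit.
Unset Printing Implicit Defensive.
Import GRing.Theory.
Local Open Scope ring_scope.

(* [pzRingType] is the structure of associative unital rings, the zero ring
   included.  [GRing.unit] needs a decidable set of units in a nontrivial ring,
   so invertibility is expressed by a two-sided inverse instead. *)
Definition is_inverse (R : pzRingType) (u v : R) : Prop :=
  u * v = 1 /\ v * u = 1.

Definition invertible (R : pzRingType) (u : R) : Prop :=
  exists v : R, is_inverse u v.

Definition unit_regular (R : pzRingType) : Prop :=
  forall a : R, exists u : R, invertible u /\ a * u * a = a.

Definition is_group_inverse (R : pzRingType) (a x : R) : Prop :=
  [/\ a * x = x * a, x * a * x = x & a * x * a = a].

(* [t] plays the role of [s^-1]. *)
Definition similar_elts (R : pzRingType) (a b : R) : Prop :=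
  exists s t : R, is_inverse s t /\ a = t * b * s.

Lemma group_inverse_unique (R : pzRingType) (a x y : R) :
  is_group_inverse a x -> is_group_inverse a y -> x = y.
Proof.
move=> [axC xax axa] [ayC yay aya].
have xxa : x * x * a = x by rewrite -mulrA -axC mulrA.
have ayy : a * y * y = y by rewrite ayC.
have -> : x = x * a * y.
  by rewrite -[x in LHS]xxa -[a in LHS]aya -(mulrA a y a) -ayC !mulrA xxa.
by rewrite -[y in RHS]ayy -[a in RHS]axa axC -!mulrA (mulrA a y) ayy.
Qed.

(* Main.v *)
Require Import Defs.
From mathcomp Require Import all_boot all_algebra.
Import GRing.Theory.
Local Open Scope ring_scope.

(** Put [m := a c] and [n := b a].  Since [m a = a n], also [x a = a y], hence
    the idempotents [p := m x] and [q := n y] satisfy [p = a (y c)] and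
    [q = (y c) a]: the elements [a q] and [y c p] are mutually inverse
    isomorphisms between [q R] and [p R], and they transport [y] to [x].  In a
    unit-regular ring the complements of isomorphic idempotents are isomorphic,
    so [a q] extends to a unit of [R], which conjugates [y] to [x]. *)

Lemma is_inverse_mul (R : pzRingType) (u u' v v' : R) :
  is_inverse u u' -> is_inverse v v' -> is_inverse (u * v) (v' * u').
Proof.
move=> [uu' u'u] [vv' v'v]; split.
  by rewrite mulrA -(mulrA u) vv' mulr1.
by rewrite mulrA -(mulrA v') u'u mulr1.
Qed.

Lemma is_inverse_unipotent (R : pzRingType) (z : R) :
  z * z = 0 -> is_inverse (1 - z) (1 + z).
Proof.
move=> zz0; split.
  by rewrite mulrDr mulr1 mulrBl mul1r zz0 subr0 subrK.
by rewrite mulrDl mul1r mulrBr mulr1 zz0 subr0 subrK.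
Qed.

(** Via [m * a = a * n], [x * a] absorbs [n * y] on the right and [a * y] absorbs [x * m] on the
    left. *)
Lemma group_inverse_intertwine (R : pzRingType) (m n a x y : R) :
  is_group_inverse m x -> is_group_inverse n y -> m * a = a * n ->
  x * a = a * y.
Proof.
move=> [mxC xmx mxm] [nyC yny nyn] maE.
have xxm : x * x * m = x by rewrite -mulrA -mxC mulrA.
have xmm : x * m * m = m by rewrite -mxC.
have nny : n * n * y = n by rewrite -mulrA nyC mulrA.
have nyy : n * y * y = y by rewrite nyC.
transitivity (x * m * a * y).
  rewrite -[x in LHS]xxm -(mulrA (x * x)) maE -[n in LHS]nny !mulrA.
  by rewrite -(mulrA (x * x)) -maE !mulrA xxm -(mulrA x) -maE mulrA.
rewrite -[y in LHS]nyy !mulrA -(mulrA (x * m)) -maE !mulrA xmm.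
by rewrite maE -!mulrA (mulrA n) nyy.
Qed.

(* [v] agrees with [a] from [g a R] to [a g R] and maps [(1 - g a) R] to
   [(1 - a g) R].  If [w] is a unit inverse to [u] with [a u a = a], then [w]
   has this property for the idempotents [u a] and [a u] in place of [g a] and
   [a g]; the unipotent factors of [v] exchange these idempotents. *)
Lemma unit_regular_extend (R : pzRingType) (a g : R) :
  unit_regular R -> a * g * a = a -> g * a * g = g ->
  exists v v' : R, [/\ is_inverse v v', v * (g * a) = a & a * g * v = a].
Proof.
move=> /(_ a) [u [[w [uw wu]] aua]] aga gag.
(* Both [a * (g * a - u * a)] and [(a * g - a * u) * a] vanish, so each difference squares to
   zero. *)
have nilr : (g * a - u * a) * (g * a - u * a) = 0.
  by rewrite mulrBl !mulrBr -!(mulrA _ a) !(mulrA a) aga aua !subrr.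
have nill : (a * g - a * u) * (a * g - a * u) = 0.
  rewrite mulrBl !mulrBr -!(mulrA a) -!mulrBr !(mulrA _ a).
  by rewrite !mulrBr !mulrA aga aua subrr.
exists ((1 - (a * g - a * u)) * (w * (1 - (g * a - u * a)))).
exists ((1 + (g * a - u * a)) * u * (1 + (a * g - a * u))).
split.
- apply: is_inverse_mul; first exact: is_inverse_unipotent.
  by apply: is_inverse_mul; last exact: is_inverse_unipotent.
- have -> : (1 - (a * g - a * u)) * (w * (1 - (g * a - u * a))) * (g * a)
            = (1 - (a * g - a * u)) * a.
    rewrite -!mulrA; congr (_ * _).
    rewrite !mulrBl mul1r -!(mulrA _ a) !(mulrA a) aga.
    by rewrite subKr mulrA wu mul1r.
  by rewrite !mulrBl mul1r aga aua subrr subr0.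
- have -> : a * g * ((1 - (a * g - a * u)) * (w * (1 - (g * a - u * a))))
            = a * (1 - (g * a - u * a)).
    rewrite !mulrA; congr (_ * _).
    rewrite !mulrBr mulr1 !mulrA aga.
    by rewrite subKr -mulrA uw mulr1.
  by rewrite !mulrBr mulr1 !mulrA aga aua subrr subr0.
Qed.

Theorem theorem2p5 (R : pzRingType) (R_ureg : unit_regular R) (a b c : R)
    (abaE : a * b * a = a * c * a) (x y : R)
    (acx : is_group_inverse (a * c) x) (bay : is_group_inverse (b * a) y) :
  similar_elts x y.
Proof.
have xaE : x * a = a * y.
  by apply: group_inverse_intertwine acx bay _; rewrite -abaE mulrA.
case: acx bay => mxC xmx mxm [nyC yny nyn].
set m := a * c in mxC xmx mxm *; set n := b * a in nyC yny nyn *.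
have aycE : a * (y * c) = x * m by rewrite mulrA -xaE /m mulrA.
(* Writing [y] as [y * y * (b * a)] exposes [a * c * a], so [abaE] applies. *)
have ycaE : y * c * a = y * n.
  have yyn : y * y * n = y by rewrite -mulrA -nyC mulrA.
  by rewrite -[y in LHS]yyn -[y in RHS]yyn /n -!mulrA !(mulrA a) abaE.
clearbody m n.
have paE : x * m * a = a * (y * n) by rewrite -aycE -ycaE !mulrA.
have pp : x * m * (x * m) = x * m by rewrite mulrA xmx.
have qq : y * n * (y * n) = y * n by rewrite mulrA yny.
have qycE : y * n * (y * c) = y * c by rewrite mulrA yny.
have fgE : a * (y * n) * (y * c * (x * m)) = x * m.
  by rewrite -(mulrA a) (mulrA (y * n)) qycE mulrA aycE pp.
have gfE : y * c * (x * m) * (a * (y * n)) = y * n.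
  by rewrite -paE -(mulrA (y * c)) (mulrA (x * m)) pp paE mulrA ycaE qq.
have [||v [v' [vv' vq pv]]] :=
  @unit_regular_extend R (a * (y * n)) (y * c * (x * m)) R_ureg.
- by rewrite fgE mulrA paE -mulrA qq.
- by rewrite gfE mulrA qycE.
rewrite gfE in vq; rewrite fgE in pv.
(* Both sides equal [a * y]. *)
have xv : x * v = v * y.
  have xp : x * (x * m) = x by rewrite -mxC mulrA.
  rewrite -[x in LHS]xp -mulrA pv mulrA xaE -[y in RHS]yny.
  by rewrite [RHS]mulrA vq -[in LHS]nyC !mulrA.
exists v', v; split; first by case: vv'.
by rewrite -xv -mulrA (proj1 vv') mulr1.
Qed.
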